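(* Let $m,n,k \in \mathbb{N}$ with $k \geq m+n-1$. Then $$\frac{P^{*}_{DP}(K_{m,n},k+1)}{(k+1)^{m+n}} \geq \frac{P^{*}_{DP}(K_{m,n},k)}{k^{m+n}}.$$
   Context: All graphs are finite, simple, and nonempty (at least one vertex). $\mathbb{N}$ denotes the set of positive integers. $K_{m,n}$ is the complete bipartite graph with partite sets of sizes $m$ and $n$. For a graph $H$ and $S_1,S_2 \subseteq V(H)$, $E_H(S_1,S_2)$ is the set of edges of $H$ with one endpoint in $S_1$ and the other in $S_2$. A (DP-)cover of a graph $G$ is a pair $\mathcal{H} = (L,H)$, where $H$ is a graph and $L: V(G) \to 2^{V(H)}$ is a function such that: (1) $\{L(v) : v \in V(G)\}$ is a partition of $V(H)$ of size $|V(G)|$; (2) for every $v \in V(G)$, the induced subgraph $H[L(v)]$ is complete; (3) if $E_H(L(u),L(v))$ is nonempty, then $u=v$ or $uv \in E(G)$; (4) if $uv \in E(G)$, then $E_H(L(u),L(v))$ is a (possibly empty) matching. The cover is $k$-fold if $|L(v)| = k$ for every $v \in V(G)$, and a $k$-fold cover is full if $|E_H(L(u),L(v))| = k$ for every $uv \in E(G)$. An $\mathcal{H}$-coloring of $G$ is an independent set in $H$ of size $|V(G)|$. The dual DP color function $P^{*}_{DP}(G,k)$ is the maximum number of $\mathcal{H}$-colorings of $G$ over all full $k$-fold covers $\mathcal{H}$ of $G$. *)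

(* Defs.v *)
From HB Require Import structures.
From mathcomp Require Import all_boot all_order all_algebra.

Set Implicit Arguments.
Unset Strict Implicit.
Unset Printing Implicit Defensive.

(* A finite simple graph with vertex type T, given by its set of edges, which
   are two-element sets of vertices. *)
Record sgraph (T : finType) := SGraph {
  edges : {set {set T}};
  edges_card2 : [forall e in edges, #|e| == 2]
}.

HB.instance Definition _ (T : finType) := [isSub for @edges T].
HB.instance Definition _ (T : finType) := [Finite of sgraph T by <:].

Definition adj (T : finType) (G : sgraph T) (u v : T) : bool :=
  [set u; v] \in edges G.

Definition edges_between (T : finType) (H : sgraph T) (S1 S2 : {set T})
    : {set {set T}} :=
  [set e in edges H | [exists x in S1, exists y in S2, e == [set x; y]]].

Definition induces_complete (T : finType) (H : sgraph T) (S : {set T}) : bool :=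
  [forall x in S, forall y in S, (x != y) ==> adj H x y].

Definition is_independent (T : finType) (H : sgraph T) (S : {set T}) : bool :=
  [forall x in S, forall y in S, ~~ adj H x y].

(* [trivIset M] says that the members of M are pairwise disjoint, i.e. that
   the set of edges M is a matching. *)
Definition is_dp_cover (V W : finType) (G : sgraph V)
    (L : {ffun V -> {set W}}) (H : sgraph W) : bool :=
  [&& partition [set L v | v : V] [set: W] && (#|[set L v | v : V]| == #|V|),
      [forall v, induces_complete H (L v)],
      [forall u, forall v,
         (edges_between H (L u) (L v) != set0) ==> (u == v) || adj G u v]
    & [forall u, forall v,
         adj G u v ==> trivIset (edges_between H (L u) (L v))]].

Definition is_fold (V W : finType) (k : nat) (L : {ffun V -> {set W}}) : bool :=
  [forall v, #|L v| == k].

Definition is_full (V W : finType) (G : sgraph V) (k : nat)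
    (L : {ffun V -> {set W}}) (H : sgraph W) : bool :=
  [forall u, forall v, adj G u v ==> (#|edges_between H (L u) (L v)| == k)].

Definition is_full_fold_cover (V W : finType) (G : sgraph V) (k : nat)
    (L : {ffun V -> {set W}}) (H : sgraph W) : bool :=
  [&& is_dp_cover G L H, is_fold k L & is_full G k L H].

Definition num_colorings (V W : finType) (G : sgraph V) (H : sgraph W) : nat :=
  #|[set S : {set W} | is_independent H S & #|S| == #|V|]|.

(* The cover graph of a k-fold cover has k * #|V| vertices, so up to isomorphism
   its vertex type may be taken to be V * 'I_k; the map L on it is arbitrary.
   See [dual_DP_ge] and [dual_DP_attained] below. *)
Definition dual_DP (V : finType) (G : sgraph V) (k : nat) : nat :=
  \max_(C : {ffun V -> {set V * 'I_k}} * sgraph (V * 'I_k)%type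
       | is_full_fold_cover G k C.1 C.2) num_colorings G C.2.

Fact Kmn_card2 (m n : nat) :
  [forall e in [set [set (inl i : 'I_m + 'I_n); inr j] | i : 'I_m, j : 'I_n],
     #|e| == 2].
Proof.
by apply/forall_inP => e /imset2P[i j _ _ ->]; rewrite cards2.
Qed.

Definition Kmn (m n : nat) : sgraph ('I_m + 'I_n)%type := SGraph (Kmn_card2 m n).

Section Transport.
Variables (V W W' : finType) (G : sgraph V) (f : W -> W').
Hypotheses (f_inj : injective f) (f_card : #|W| = #|W'|).

Let F := fun e : {set W} => f @: e.

Let F_inj : injective F.
Proof. exact: imset_inj. Qed.

Let f_pair x y : f @: [set x; y] = [set f x; f y].
Proof. by rewrite imsetU1 imset_set1. Qed.

Let f_onto : f @: [set: W] = [set: W'].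
Proof.
by apply/eqP; rewrite eqEcard subsetT /= card_imset // !cardsT f_card leqnn.
Qed.

Let push_card2 (H : sgraph W) : [forall e in F @: edges H, #|e| == 2].
Proof.
apply/forall_inP => e /imsetP[d dH ->]; rewrite card_imset //.
by have /forall_inP := edges_card2 H; apply.
Qed.

Let push (H : sgraph W) : sgraph W' := SGraph (push_card2 H).
Let pushL (L : {ffun V -> {set W}}) : {ffun V -> {set W'}} :=
  [ffun v => f @: L v].

Let push_adj H x y : adj (push H) (f x) (f y) = adj H x y.
Proof. by rewrite /adj /= -f_pair -/(F _) mem_imset. Qed.

Let push_between H (S1 S2 : {set W}) :
  edges_between (push H) (f @: S1) (f @: S2) = F @: edges_between H S1 S2.
Proof.
apply/setP => e; rewrite inE; apply/andP/imsetP.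
  case=> /imsetP[d dH ->] /exists_inP[_ /imsetP[x xS1 ->]].
  case/exists_inP=> _ /imsetP[y yS2 ->]; rewrite -f_pair => /eqP/F_inj ed.
  exists d => //; rewrite inE dH; apply/exists_inP; exists x => //.
  by apply/exists_inP; exists y => //; rewrite ed.
case=> d; rewrite inE => /andP[dH /exists_inP[x xS1 /exists_inP[y yS2 /eqP ed]]].
move=> ->; split; first exact: imset_f.
apply/exists_inP; exists (f x); first exact: imset_f.
apply/exists_inP; exists (f y); first exact: imset_f.
by rewrite ed -f_pair.
Qed.

Let push_full_fold_cover k L H :
  is_full_fold_cover G k L H -> is_full_fold_cover G k (pushL L) (push H).
Proof.
case/and3P=> /and4P[/andP[partL cardL] cplL edgL matL] foldL fullL.
have imL : [set pushL L v | v : V] = F @: [set L v | v : V].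
  by rewrite -imset_comp; apply: eq_imset => v; rewrite /= ffunE.
apply/and3P; split; last 1 first.
- apply/forallP => u; apply/forallP => v; rewrite !ffunE push_between.
  by rewrite card_imset //; have /forallP/(_ u)/forallP/(_ v) := fullL.
- apply/and4P; split.
  + by rewrite imL -f_onto imset_partition // partL card_imset.
  + apply/forallP => v; rewrite ffunE; have /forallP/(_ v) := cplL.
    move=> /forall_inP cv; apply/forall_inP => _ /imsetP[x xL ->].
    apply/forall_inP => _ /imsetP[y yL ->]; rewrite (inj_eq f_inj) push_adj.
    by have /forall_inP := cv x xL; apply.
  + apply/forallP => u; apply/forallP => v; rewrite !ffunE push_between.
    rewrite -cards_eq0 card_imset // cards_eq0.
    by have /forallP/(_ u)/forallP/(_ v) := edgL.
  + apply/forallP => u; apply/forallP => v; rewrite !ffunE push_between.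
    by rewrite imset_trivIset //; have /forallP/(_ u)/forallP/(_ v) := matL.
- apply/forallP => v; rewrite ffunE card_imset //.
  by have /forallP/(_ v) := foldL.
Qed.

Let push_num_colorings H : num_colorings G H <= num_colorings G (push H).
Proof.
rewrite /num_colorings -(card_imset _ F_inj); apply/subset_leq_card/subsetP.
move=> _ /imsetP[S /[!inE] /andP[/forall_inP indS cS] ->].
rewrite card_imset // cS andbT; apply/forall_inP => _ /imsetP[x xS ->].
apply/forall_inP => _ /imsetP[y yS ->]; rewrite push_adj.
by have /forall_inP := indS x xS; apply.
Qed.

Lemma transport_full_fold_cover k (L : {ffun V -> {set W}}) (H : sgraph W) :
  is_full_fold_cover G k L H ->
  exists (L' : {ffun V -> {set W'}}) (H' : sgraph W'),
    is_full_fold_cover G k L' H' /\ num_colorings G H <= num_colorings G H'.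
Proof.
by move=> ck; exists (pushL L), (push H); split; first exact: push_full_fold_cover.
Qed.
End Transport.

Lemma fold_cover_card (V W : finType) (G : sgraph V) k
    (L : {ffun V -> {set W}}) (H : sgraph W) :
  is_full_fold_cover G k L H -> #|W| = #|V| * k.
Proof.
case/and3P=> /and4P[/andP[partL /eqP cardL] _ _ _] /forallP foldL _.
rewrite -cardsT (@card_uniform_partition _ k _ _ _ partL) ?cardL //.
by move=> _ /imsetP[v _ ->]; apply/eqP.
Qed.

Lemma dual_DP_ge (V W : finType) (G : sgraph V) (k : nat)
    (L : {ffun V -> {set W}}) (H : sgraph W) :
  is_full_fold_cover G k L H -> num_colorings G H <= dual_DP G k.
Proof.
move=> ck; have cW : #|W| = #|{: V * 'I_k}|.
  by rewrite (fold_cover_card ck) card_prod card_ord.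
pose f x : V * 'I_k := enum_val (cast_ord cW (enum_rank x)).
have f_inj : injective f.
  by move=> x y /enum_val_inj/cast_ord_inj/enum_rank_inj.
have [L' [H' [ck' leH]]] := transport_full_fold_cover f_inj cW ck.
apply: leq_trans leH _.
exact: (@leq_bigmax_cond _ _ (fun C => num_colorings G C.2) (L', H')).
Qed.

Lemma full_fold_cover_exists (V : finType) (G : sgraph V) (k : nat) :
  0 < k ->
  exists (L : {ffun V -> {set V * 'I_k}}) (H : sgraph (V * 'I_k)%type),
    is_full_fold_cover G k L H.
Proof.
move=> k_gt0; pose W := (V * 'I_k)%type.
pose r (x y : W) := (x.1 == y.1) || adj G x.1 y.1 && (x.2 == y.2).
have adjC u v : adj G u v = adj G v u by rewrite /adj setUC.
have rC x y : r x y = r y x by rewrite /r eq_sym adjC (eq_sym x.2).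
pose E := [set e : {set W} |
  [exists x, exists y, [&& x != y, r x y & e == [set x; y]]]].
have E2 : [forall e in E, #|e| == 2].
  apply/forall_inP => e; rewrite inE => /existsP[x /existsP[y /and3P[xy _]]].
  by move=> /eqP->; rewrite cards2 xy.
pose H := SGraph E2; pose L := [ffun v => [set x : W | x.1 == v]].
have adjH x y : adj H x y = (x != y) && r x y.
  rewrite /adj inE; apply/existsP/andP; last first.
    by case=> xy rxy; exists x; apply/existsP; exists y; rewrite xy rxy eqxx.
  case=> a /existsP[b /and3P[ab rab /eqP eqs]].
  have xy : x != y.
    by apply: contraNneq ab => xy; move: (cards2 a b); rewrite -eqs xy setUid
      cards1; case: eqP.
  have : x \in [set a; b] by rewrite -eqs set21.
  have : y \in [set a; b] by rewrite -eqs set22.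
  rewrite !inE => /orP[]/eqP ya /orP[]/eqP xa; subst x y => //;
    rewrite ?eqxx // in xy *; by rewrite xy // rC.
have betw u v : adj G u v -> edges_between H (L u) (L v) =
    [set [set (u, i); (v, i)] | i : 'I_k].
  move=> uv; have uNv : u != v.
    have /forall_inP/(_ _ uv) := edges_card2 G; rewrite cards2.
    by case: (u != v).
  apply/setP => e; rewrite inE; apply/andP/imsetP.
    case=> eE /exists_inP[[a i]]; rewrite ffunE inE /= => /eqP eau; subst a.
    case/exists_inP=> -[b j]; rewrite ffunE inE /= => /eqP ebv /eqP ee; subst b e.
    have : adj H (u, i) (v, j) by [].
    rewrite adjH /r /= (negbTE uNv) /= => /and3P[_ _ /eqP->].
    by exists j.
  case=> i _ ->; split.
    have : adj H (u, i) (v, i) by rewrite adjH /r /= uv eqxx orbT andbT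
      xpair_eqE (negbTE uNv).
    by [].
  apply/exists_inP; exists (u, i); first by rewrite ffunE inE.
  by apply/exists_inP; exists (v, i); first by rewrite ffunE inE.
have L_inj : injective L.
  move=> u v Luv; have : (u, Ordinal k_gt0) \in L v by rewrite -Luv ffunE inE.
  by rewrite ffunE inE => /eqP.
exists L, H; apply/and3P; split.
- apply/and4P; split.
  + rewrite card_imset // eqxx andbT; apply/and3P; split.
    * apply/eqP/setP => -[v i]; rewrite inE; apply/bigcupP.
      by exists (L v); rewrite ?imset_f // ffunE inE.
    * apply/trivIsetP => _ _ /imsetP[u _ ->] /imsetP[v _ ->].
      rewrite (inj_eq L_inj) => uNv; rewrite -setI_eq0; apply/eqP/setP => x.
      rewrite !ffunE !inE; apply/andP=> -[/eqP-> /eqP uv].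
      by rewrite uv eqxx in uNv.
    * apply/imsetP => -[v _] /setP/(_ (v, Ordinal k_gt0)).
      by rewrite ffunE !inE eqxx.
  + apply/forallP => v; apply/forall_inP => x; rewrite ffunE inE => /eqP xv.
    apply/forall_inP => y; rewrite inE => /eqP yv; apply/implyP => xy.
    by rewrite adjH xy /r xv yv eqxx.
  + apply/forallP => u; apply/forallP => v; apply/implyP => /set0Pn[e].
    rewrite inE => /andP[eE /exists_inP[x]]; rewrite ffunE inE => /eqP xu.
    case/exists_inP=> y; rewrite ffunE inE => /eqP yv /eqP ee; subst e u v.
    have : adj H x y by [].
    by rewrite adjH /r => /andP[_ /orP[->|/andP[-> _]]] //; rewrite orbT.
  + apply/forallP => u; apply/forallP => v; apply/implyP => uv.
    rewrite betw //; apply/trivIsetP => _ _ /imsetP[i _ ->] /imsetP[j _ ->] eij.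
    have iNj : i != j by apply: contraNneq eij => ->.
    rewrite -setI_eq0; apply/eqP/setP => -[a l]; rewrite !inE !xpair_eqE.
    by apply/negbTE; apply: contraNN iNj => /andP[
      /orP[]/andP[_ /eqP<-] /orP[]/andP[_ /eqP<-]].
- apply/forallP => v; rewrite ffunE.
  have -> : [set x : W | x.1 == v] = [set (v, i) | i : 'I_k].
    apply/setP => -[a i]; rewrite inE /=; apply/eqP/imsetP => [->|[j _ []]//].
    by exists i.
  by rewrite card_imset ?card_ord // => i j [].
- apply/forallP => u; apply/forallP => v; apply/implyP => uv.
  rewrite betw // card_imset ?card_ord // => i j eij.
  have uNv : u != v.
    have /forall_inP/(_ _ uv) := edges_card2 G; rewrite cards2.
    by case: (u != v).
  have : (u, i) \in [set (u, j); (v, j)] by rewrite -eij set21.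
  by rewrite !inE !xpair_eqE (negbTE uNv) orbF => /andP[_ /eqP].
Qed.

Lemma dual_DP_attained (V : finType) (G : sgraph V) (k : nat) :
  0 < k ->
  exists (L : {ffun V -> {set V * 'I_k}}) (H : sgraph (V * 'I_k)%type),
    is_full_fold_cover G k L H /\ num_colorings G H = dual_DP G k.
Proof.
move=> k_gt0; have [L0 [H0 c0]] := full_fold_cover_exists G k_gt0.
have /(eq_bigmax_cond (fun C => num_colorings G C.2)) : 0 <
    #|[pred C : {ffun V -> {set V * 'I_k}} * sgraph (V * 'I_k)%type
        | is_full_fold_cover G k C.1 C.2]|.
  by apply/card_gt0P; exists (L0, H0).
by case=> -[L H] /= ck eqm; exists L, H; split.
Qed.

(* Main.v *)
Require Import Defs.
From mathcomp Require Import all_boot all_order all_algebra.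
From mathcomp Require Import zify ring lra.

(** Call pairs of maps x : A -> S, y : B -> S with disjoint images disjoint
    pairs; for A = 'I_m, B = 'I_n these are the proper colourings of K_{m,n}
    with colours in S.  The proof has two halves.

    The dual DP colour function of K_{m,n} counts proper colourings
    ([dual_DP_Kmn]).  A full cover amounts to a family of bijections s_ij from
    the i-th left list to the j-th right list, and its colourings are counted
    by the sum over x of prod_j f_j(x), where f_j(x) is the number of colours
    of the j-th right list missed by all s_ij(x_i).
    By the arithmetic-geometric mean inequality the product is at most the mean
    over j of f_j(x)^n, and the sum over x of f_j(x)^n does not depend on the
    bijections, because x |-> (s_ij(x_i))_i is itself a bijection.  Hence no
    full cover beats the one with identity matchings, whose colourings are the
    proper colourings.

    It remains to compare the numbers P(k+1) and P(k) of proper colourings and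
    to show P(k+1) >= c^(m+n) P(k) for c = 1 + 1/k ([disjoint_pairs_growth]).
    Single out one of the k+1 colours.  At most one side of K_{m,n} uses it, so
    P(k+1) + P(k) = P_left + P_right, where on one side the extra colour is
    allowed and on the other it is not ([disjoint_pairs_setD1]).  If q(y) is the
    number of the k ordinary colours not used by y and g_i is the sum of q(y)^i,
    then P_left is the sum of (q(y)+1)^m, that is, the sum over a of
    binom(m,a) g_(m-a), while P(k) = g_m.  The key estimate is
    k g_(i-1) >= (1 + c^n)/2 g_i for i <= m ([moment_ratioW]), from which
    P_left >= (1 + (1 + c^n)/2 (c^m - 1)) P(k) ([extra_color]).  With the
    symmetric bound for P_right, the factors add up exactly to c^(m+n).

    The key estimate says that the free colours have density at most
    2/(1 + c^n).  Given the colours of at most m-1 left vertices, the right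
    vertices are coloured independently from at least k-m+1 >= n colours, and
    n independent choices among at least n colours hit at least n/2 distinct
    ones on average ([sum_card_image_ge]).  So the density of free colours is
    at most 1 - n/(2k), and (1 + c^n)(1 - n/(2k)) <= 2 ([expr_growth]). *)

Set Implicit Arguments.
Unset Strict Implicit.
Unset Printing Implicit Defensive.

Import Order.TTheory GRing.Theory Num.Theory.
Local Open Scope nat_scope.

(** * Pairs of maps with disjoint images *)

Section DisjointPairs.
Variable T : finType.
Implicit Types (A B : finType) (S R : {set T}).

Definition color_disjoint A B (x : {ffun A -> T}) (y : {ffun B -> T}) :=
  [forall a, forall b, x a != y b].

Lemma color_disjointC A B (x : {ffun A -> T}) (y : {ffun B -> T}) :
  color_disjoint y x = color_disjoint x y.
Proof.
by apply/forallP/forallP => h a; apply/forallP => b;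
  have /forallP/(_ a) := h b; rewrite eq_sym.
Qed.

Definition disjoint_pairs A B S R : {set {ffun A -> T} * {ffun B -> T}} :=
  [set p | [&& p.1 \in ffun_on (mem S), p.2 \in ffun_on (mem R)
             & color_disjoint p.1 p.2]].

Lemma ffun_on_setD A B S (y : {ffun B -> T}) (x : {ffun A -> T}) :
  (x \in ffun_on (mem (S :\: y @: B))) =
  (x \in ffun_on (mem S)) && color_disjoint x y.
Proof.
apply/ffun_onP/andP.
  move=> h; split.
    by apply/ffun_onP => a; have := h a; rewrite inE => /andP[].
  apply/forallP => a; apply/forallP => b; have := h a; rewrite inE => /andP[yN _].
  by apply: contraNneq yN => ->; exact: imset_f.
case=> /ffun_onP hS /forallP hd a; rewrite inE hS andbT.
by apply/imsetP => -[b _ e]; have /forallP/(_ b) := hd a; rewrite e eqxx.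
Qed.

(** Disjointness is symmetric, so a weighted sum over disjoint pairs may be
    organised by either component. *)
Lemma exchange_disjoint A B S R (F : {ffun A -> T} -> {ffun B -> T} -> nat) :
  \sum_(x in ffun_on (mem S)) \sum_(y in ffun_on (mem (R :\: x @: A))) F x y =
  \sum_(y in ffun_on (mem R)) \sum_(x in ffun_on (mem (S :\: y @: B))) F x y.
Proof.
rewrite (exchange_big_dep (fun y => y \in ffun_on (mem R))) /=.
  apply: eq_bigr => y yR; apply: eq_bigl => x.
  by rewrite !ffun_on_setD yR color_disjointC.
by move=> x y _; rewrite ffun_on_setD => /andP[].
Qed.

Lemma card_disjoint_pairs A B S R :
  #|disjoint_pairs A B S R| =
  \sum_(x in ffun_on (mem S)) #|R :\: x @: A| ^ #|B|.
Proof.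
under eq_bigr => x _ do rewrite -card_ffun_on -sum1_card.
rewrite pair_big_dep -sum1_card /=; apply: eq_bigl => -[x y].
by rewrite inE /= ffun_on_setD color_disjointC.
Qed.

Lemma disjoint_pairsC A B S R :
  #|disjoint_pairs A B S R| = #|disjoint_pairs B A R S|.
Proof.
rewrite !card_disjoint_pairs.
under eq_bigr => x _ do rewrite -card_ffun_on -sum1_card.
rewrite exchange_disjoint; apply: eq_bigr => y _.
by rewrite sum1_card card_ffun_on.
Qed.

(** The two maps of a disjoint pair cannot both take the value [c], so every
    such pair avoids [c] on one side at least; this is inclusion-exclusion. *)
Lemma disjoint_pairs_setD1 A B c :
  #|disjoint_pairs A B [set: T] [set: T]|
    + #|disjoint_pairs A B [set~ c] [set~ c]| =
  #|disjoint_pairs A B [set: T] [set~ c]|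
    + #|disjoint_pairs A B [set~ c] [set: T]|.
Proof.
have onT (D : finType) (x : {ffun D -> T}) : [forall d, x d \in mem [set: T]].
  by apply/forallP => d; rewrite inE.
rewrite -[RHS]cardsUI; congr addn; apply: eq_card => -[x y];
  rewrite !inE /= !onT /=.
  rewrite -andb_orl; case d: color_disjoint; rewrite ?andbF // andbT.
  case: (boolP [forall b, _]) => //= /forallPn[b]; rewrite /= !inE negbK => /eqP yb.
  symmetry; apply/forallP => a; rewrite !inE -yb.
  by have /forallP/(_ a)/forallP := d.
by case: color_disjoint; rewrite ?andbF ?andbT // andbC.
Qed.

End DisjointPairs.

(** The colour [t] only witnesses that [T'] is inhabited; it is the default
    value of the injection from [S] to [S']. *)
Lemma leq_disjoint_pairs (A B T T' : finType) (S : {set T}) (S' : {set T'})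
    (t : T') :
  #|S| <= #|S'| -> #|disjoint_pairs A B S S| <= #|disjoint_pairs A B S' S'|.
Proof.
move=> leS; pose f s := nth t (enum S') (index s (enum S)).
have ltS s : s \in S -> index s (enum S) < size (enum S').
  by rewrite -mem_enum -index_mem -!cardE => /leq_trans; apply.
have fS s : s \in S -> f s \in S'.
  by move=> sS; rewrite -mem_enum mem_nth // ltS.
have f_inj : {in S &, injective f}.
  move=> s s' sS s'S /eqP; rewrite nth_uniq ?ltS ?enum_uniq // => /eqP e.
  by rewrite -[s](nth_index s (s := enum S)) ?mem_enum // e nth_index ?mem_enum.
pose F (p : {ffun A -> T} * {ffun B -> T}) :=
  ([ffun a => f (p.1 a)], [ffun b => f (p.2 b)]).
rewrite -(card_in_imset (f := F)) => [|[x y] [x' y']]; last first.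
  rewrite inE /= => /and3P[/ffun_onP xS /ffun_onP yS _].
  rewrite inE /= => /and3P[/ffun_onP x'S /ffun_onP y'S _] [/ffunP ex /ffunP ey].
  congr pair; apply/ffunP => i.
    by have := ex i; rewrite !ffunE; apply: f_inj.
  by have := ey i; rewrite !ffunE; apply: f_inj.
apply/subset_leq_card/subsetP => _ /imsetP[[x y] + ->].
rewrite inE /= => /and3P[/ffun_onP xS /ffun_onP yS /forallP d]; rewrite inE /=.
apply/and3P; split.
- by apply/ffun_onP => a; rewrite ffunE fS // xS.
- by apply/ffun_onP => b; rewrite ffunE fS // yS.
- apply/forallP => a; apply/forallP => b; rewrite !ffunE.
  have /forallP/(_ b) := d a; apply: contra => /eqP e.
  by apply/eqP/f_inj.
Qed.

(** * The number of distinct values of a random map *)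

(** Divided by 2 q^(n+1) this is (1 - 1/q)^n <= 1 - n/(2q), which is proved by
    induction on n: the step needs (n/(2q)) (1/q) <= 1/(2q), that is n <= q. *)
Lemma half_le_occupancy (q n : nat) :
  n <= q -> n * q ^ n <= 2 * (q * (q ^ n - q.-1 ^ n)).
Proof.
case: q => [|q]; first by rewrite leqn0 => /eqP->.
move=> nq; rewrite /=.
suff: n * q.+1 ^ n + 2 * q.+1 * q ^ n <= 2 * q.+1 * q.+1 ^ n.
  have: q ^ n <= q.+1 ^ n by case: n {nq} => // n; rewrite leq_exp2r.
  nia.
elim: n nq => [|n IHn] nq; first by rewrite !expn0; lia.
have := IHn (ltnW nq); rewrite !expnS.
move: (q ^ n) (q.+1 ^ n) => u v h.
nia.
Qed.

Section Occupancy.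
Variables (B T : finType).
Implicit Types (S R : {set T}).

(** Linearity of expectation: a colour [c] of [R] is hit by all maps into [R]
    but those into [R :\ c]. *)
Lemma sum_card_image R :
  \sum_(y : {ffun B -> T} | y \in ffun_on (mem R)) #|y @: B| =
  #|R| * (#|R| ^ #|B| - #|R|.-1 ^ #|B|).
Proof.
transitivity (\sum_(c in R)
  \sum_(y : {ffun B -> T} | (y \in ffun_on (mem R)) && (c \in y @: B)) 1).
  rewrite (exchange_big_dep (fun y : {ffun B -> T} => y \in ffun_on (mem R))) /=;
    last by move=> c y _ /andP[].
  apply: eq_bigr => y yR; rewrite yR sum1_card.
  apply: eq_card => c; rewrite [RHS]inE; apply/idP/andP => [cy|[_ //]].
  split=> //; have /imsetP[b _ ->] := cy; exact: (ffun_onP yR).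
rewrite -sum_nat_const; apply: eq_bigr => c cR.
have <- : #|R :\ c| = #|R|.-1 by rewrite (cardsD1 c R) cR.
rewrite -!card_ffun_on sum1_card.
pose P := [pred y : {ffun B -> T} | c \in y @: B].
have <- : #|[predD ffun_on R & P]| =
    #|[pred y : {ffun B -> T} | y \in ffun_on (R :\ c)]|.
  apply: eq_card => y; rewrite [LHS]inE; apply/andP/ffun_onP.
    case=> /= cy /ffun_onP yR b; rewrite !inE yR andbT.
    by apply: contraNneq cy => e; rewrite inE /= -e imset_f.
  move=> yRc; split; last first.
    by apply/ffun_onP => b; have := yRc b; rewrite !inE => /andP[].
  by apply/imsetP => -[b _ cb]; have := yRc b; rewrite -cb !inE eqxx.
by rewrite -(cardID P (ffun_on R)) addnK; apply: eq_card => y; rewrite inE.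
Qed.

Lemma sum_card_image_ge R : #|B| <= #|R| ->
  #|B| * #|R| ^ #|B| <=
  2 * \sum_(y : {ffun B -> T} | y \in ffun_on (mem R)) #|y @: B|.
Proof. by move=> leR; rewrite sum_card_image half_le_occupancy. Qed.

(** The weight [#|S :\: y @: B| ^ #|A|] counts the maps A -> S whose image is
    disjoint from that of [y].  Fixing such a map first, [y] becomes a uniform
    map into at least [#|B|] remaining colours, so the unweighted bound holds
    for each of them. *)
Lemma sum_card_image_weighted (A : finType) S : #|A| + #|B| <= #|S| ->
  #|B| * (\sum_(y : {ffun B -> T} | y \in ffun_on (mem S))
            #|S :\: y @: B| ^ #|A|) <=
  2 * \sum_(y : {ffun B -> T} | y \in ffun_on (mem S))
        #|y @: B| * #|S :\: y @: B| ^ #|A|.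
Proof.
move=> leS; rewrite -card_disjoint_pairs disjoint_pairsC card_disjoint_pairs.
under [in leqRHS]eq_bigr => y _ do rewrite mulnC -card_ffun_on -sum_nat_const.
rewrite exchange_disjoint !big_distrr; apply: leq_sum => x /ffun_onP xS.
apply: sum_card_image_ge; rewrite cardsD (setIidPr _).
  apply: leq_trans (leq_sub2l _ (leq_imset_card _ _)).
  by rewrite leq_subRL //; apply: leq_trans leS; rewrite leq_addr.
by apply/subsetP => _ /imsetP[a _ ->]; exact: xS.
Qed.

End Occupancy.

(** * The effect of one extra colour *)

Local Open Scope ring_scope.

(** Equivalently (1 + 1/k)^n <= (2k + n)/(2k - n), the first Pade approximant
    of the exponential at n/k.  The inductive step reduces to
    (2k + n)(2k - n - 1)(k + 1) <= (2k + n + 1)(2k - n) k, whose two sides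
    differ by n^2 + n + 2k. *)
Lemma expr_growth (k n : nat) : (n <= k)%N ->
  (1 + (1 + k%:R^-1) ^+ n) * (2 * k%:R - n%:R) <= 4 * k%:R :> rat.
Proof.
have [->|k_gt0] := posnP k.
  by rewrite leqn0 => /eqP->; rewrite mulr0n; lra.
have k0 : 0 < k%:R :> rat by rewrite ltr0n.
suff H : (n <= k)%N ->
    (1 + k%:R^-1) ^+ n * (2 * k%:R - n%:R) <= 2 * k%:R + n%:R :> rat.
  by move=> /H; lra.
elim: n => [|n IHn] nk; first by rewrite expr0; lra.
have /IHn := ltnW nk; have : n%:R + 1 <= k%:R :> rat by rewrite natr1 ler_nat.
have -> : n.+1%:R = n%:R + 1 :> rat by rewrite natr1.
rewrite exprS; have := ler0n rat n.
move: n%:R k%:R k0 (_ ^+ n) => x y y0 c x0 xy h.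
have d0 : 0 < 2 * y - x by lra.
rewrite -(ler_pM2l d0).
have -> : (2 * y - x) * ((1 + y^-1) * c * (2 * y - (x + 1))) =
  (c * (2 * y - x)) * ((1 + y^-1) * (2 * y - (x + 1))) by ring.
have p0 : 0 <= (1 + y^-1) * (2 * y - (x + 1)).
  by apply: mulr_ge0; [have : 0 < y^-1 by rewrite invr_gt0|]; lra.
apply: le_trans (ler_wpM2r p0 h) _.
rewrite -(ler_pM2l y0).
have -> : y * ((2 * y + x) * ((1 + y^-1) * (2 * y - (x + 1)))) =
  (2 * y + x) * ((y + 1) * (2 * y - (x + 1))) by field; lra.
nra.
Qed.

Section ExtraColor.
Variables (B T : finType) (S : {set T}).
(** Up to normalisation, the moments of the number of colours of [S] left free
    by a random map B -> S. *)
Local Notation moment i :=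
  (\sum_(y : {ffun B -> T} | y \in ffun_on (mem S)) #|S :\: y @: B| ^ i)%N.

Lemma card_free_colors (y : {ffun B -> T}) : y \in ffun_on (mem S) ->
  (#|S :\: y @: B| + #|y @: B| = #|S|)%N.
Proof.
move=> /ffun_onP yS; rewrite cardsD (setIidPr _) ?subnK //.
  by apply/subset_leq_card/subsetP => _ /imsetP[b _ ->]; exact: yS.
by apply/subsetP => _ /imsetP[b _ ->]; exact: yS.
Qed.

Lemma leq_moment (i : nat) : (moment i.+1 <= #|S| * moment i)%N.
Proof.
rewrite big_distrr; apply: leq_sum => y yS; rewrite expnS leq_mul2r.
by rewrite -(card_free_colors yS) leq_addr orbT.
Qed.

(** As [#|y @: B| = #|S| - #|S :\: y @: B|], the weighted average of the number
    of used colours turns into a bound between consecutive moments. *)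
Lemma moment_ratio (i : nat) : (i + #|B| <= #|S|)%N ->
  (2 * moment i.+1 + #|B| * moment i <= 2 * #|S| * moment i)%N.
Proof.
move=> le; have := sum_card_image_weighted (B := B) (A := 'I_i) (S := S).
rewrite card_ord => /(_ le); set e := (\sum_(_ | _) (_ * _))%N => le'.
suff : (moment i.+1 + e = #|S| * moment i)%N by move: le' => /=; lia.
rewrite -big_split big_distrr; apply: eq_bigr => y yS /=.
by rewrite expnS -mulnDl card_free_colors.
Qed.

(** By [expr_growth], the factor 2k - n of [moment_ratio] (k = #|S|, n = #|B|)
    is at most 4k / (1 + (1 + 1/k)^n).  This weaker constant is the one for which
    the bounds for the two sides add up exactly in [disjoint_pairs_growth]. *)
Lemma moment_ratioW (i : nat) : (i + #|B| <= #|S|)%N ->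
  (1 + (1 + #|S|%:R^-1) ^+ #|B|) / 2 * (moment i.+1)%:R
  <= #|S|%:R * (moment i)%:R :> rat.
Proof.
move=> le; have := moment_ratio le; rewrite -(ler_nat rat) !natrD !natrM.
have := expr_growth (leq_trans (leq_addl i #|B|) le).
move: (moment i.+1)%:R (ler0n rat (moment i.+1)) => u u0.
move: (moment i)%:R (ler0n rat (moment i)) => v v0; set r := 1 + _ => h1 h2.
have : 0 <= r by rewrite addr_ge0 // exprn_ge0 // addr_ge0 // invr_ge0 ler0n.
have : #|B|%:R <= #|S|%:R :> rat by rewrite ler_nat (leq_trans (leq_addl i #|B|)).
move: #|B|%:R #|S|%:R h1 h2 => n k h1 h2 nk r0.
nra.
Qed.

(** The first step down gains the factor of [moment_ratioW]; for the other steps the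
    trivial [leq_moment] is enough. *)
Lemma moment_drop (i a : nat) : (i + a + #|B| <= #|S|)%N ->
  (1 + (1 + #|S|%:R^-1) ^+ #|B|) / 2 * (moment (i + a).+1)%:R
  <= #|S|%:R ^+ a.+1 * (moment i)%:R :> rat.
Proof.
move=> le; apply: le_trans (moment_ratioW le) _.
rewrite exprS -mulrA; apply: ler_wpM2l; first exact: ler0n.
rewrite -natrX -natrM ler_nat; elim: a {le} => [|a IHa].
  by rewrite addn0 mul1n.
by rewrite addnS expnS -mulnA (leq_trans (leq_moment _)) // leq_mul2l IHa orbT.
Qed.

(** Expand (q + 1)^m binomially: the leading term is the moment of order m, and
    each other term is bounded below by [moment_drop] with the same factor. *)
Lemma extra_color (m : nat) : (m + #|B| <= #|S|.+1)%N -> (0 < #|S|)%N ->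
  (1 + (1 + (1 + #|S|%:R^-1) ^+ #|B|) / 2 * ((1 + #|S|%:R^-1) ^+ m - 1))
    * (moment m)%:R
  <= (\sum_(y : {ffun B -> T} | y \in ffun_on (mem S))
        #|S :\: y @: B|.+1 ^ m)%N%:R :> rat.
Proof.
move=> le k_gt0; set k : rat := #|S|%:R; set r := _ / 2.
have k0 : 0 < k by rewrite ltr0n.
have -> : (\sum_(y : {ffun B -> T} | y \in ffun_on (mem S))
             #|S :\: y @: B|.+1 ^ m =
           \sum_(j < m.+1) 'C(m, j) * moment (m - j))%N.
  under eq_bigr => y _ do rewrite -addn1 Pascal.
  rewrite exchange_big; apply: eq_bigr => j _ /=; rewrite big_distrr.
  by apply: eq_bigr => y _; rewrite exp1n muln1.
have -> : (1 + k^-1) ^+ m = 1 + \sum_(j < m) k^-1 ^+ j.+1 *+ 'C(m, j.+1).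
  rewrite exprDn big_ord_recl /= expr1n mul1r bin0.
  by congr (_ + _); apply: eq_bigr => j _; rewrite expr1n mul1r.
rewrite big_ord_recl bin0 mul1n subn0 natrD [X in _ <= _ + X]natr_sum.
have addrKl (x : rat) : 1 + x - 1 = x by ring.
rewrite addrKl mulrDl mul1r lerD2l mulr_sumr mulr_suml.
apply: ler_sum => -[j jm] _ /=.
rewrite natrM -mulr_natl.
have -> : r * ('C(m, j.+1)%:R * k^-1 ^+ j.+1) * (moment m)%:R =
  'C(m, j.+1)%:R * (k^-1 ^+ j.+1 * (r * (moment m)%:R)) by ring.
apply: ler_wpM2l; first exact: ler0n.
rewrite exprVn -(ler_pM2l (exprn_gt0 j.+1 k0)) mulVKf ?expf_neq0 ?gt_eqF //.
have em : m = (m - j.+1 + j).+1 by lia.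
by rewrite {1}em; apply: moment_drop; lia.
Qed.

End ExtraColor.

(** A map avoiding [c] leaves free, besides [c] itself, the colours it leaves
    free among the others; hence the successor in [extra_color]. *)
Lemma disjoint_pairs_extra (A B T : finType) (c : T) :
  (0 < #|[set~ c]|)%N -> (#|A| + #|B| <= #|[set~ c]|.+1)%N ->
  (1 + (1 + (1 + #|[set~ c]|%:R^-1) ^+ #|B|) / 2
         * ((1 + #|[set~ c]|%:R^-1) ^+ #|A| - 1))
    * #|disjoint_pairs A B [set~ c] [set~ c]|%:R
  <= #|disjoint_pairs A B [set: T] [set~ c]|%:R :> rat.
Proof.
move=> k_gt0 le; rewrite !(disjoint_pairsC A B) !card_disjoint_pairs.
apply: le_trans (extra_color le k_gt0) _; rewrite ler_nat.
apply: leq_sum => y /ffun_onP yS.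
suff -> : [set: T] :\: y @: B = c |: ([set~ c] :\: y @: B).
  by rewrite cardsU1 !inE eqxx andbF.
apply/setP => t; rewrite !inE andbT; case: eqVneq => [->|_]; last by rewrite andbT.
by apply/imsetP => -[b _ cb]; have := yS b; rewrite -cb !inE eqxx.
Qed.

Lemma disjoint_pairs_growth (A B : finType) (k : nat) :
  (0 < k)%N -> (#|A| + #|B| <= k.+1)%N ->
  (1 + k%:R^-1) ^+ (#|A| + #|B|)
    * #|disjoint_pairs A B [set: 'I_k] [set: 'I_k]|%:R
  <= #|disjoint_pairs A B [set: 'I_k.+1] [set: 'I_k.+1]|%:R :> rat.
Proof.
move=> k_gt0 le; pose c : 'I_k.+1 := ord_max; set S := [set~ c].
have cS : #|S| = k by rewrite cardsC1 card_ord.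
have le0 : (#|disjoint_pairs A B [set: 'I_k] [set: 'I_k]|
            <= #|disjoint_pairs A B S S|)%N.
  by apply: (leq_disjoint_pairs _ _ c); rewrite cS cardsT card_ord.
have := disjoint_pairs_setD1 A B c; rewrite -/S => /(congr1 (fun n => n%:R : rat)).
rewrite !natrD.
have := @disjoint_pairs_extra A B _ c; rewrite -/S cS => /(_ k_gt0 le).
have := @disjoint_pairs_extra B A _ c; rewrite -/S cS addnC => /(_ k_gt0 le).
rewrite !(disjoint_pairsC B A).
move: le0; rewrite -(ler_nat rat) exprD.
have c0 : 0 <= 1 + k%:R^-1 :> rat by rewrite addr_ge0 // invr_ge0 ler0n.
have := exprn_ge0 #|B| c0; have := exprn_ge0 #|A| c0.
move: (_ ^+ #|A|) (_ ^+ #|B|) => a b a0 b0 le1 ge1 ge2 eq1.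
have := ler_wpM2l (mulr_ge0 a0 b0) le1.
(* (1 + (1+b)(a-1)/2) + (1 + (1+a)(b-1)/2) - 1 = a b. *)
move: eq1 ge1 ge2; clear cS; do 5!move: (#|_|%:R : rat).
by move=> x1 x2 x3 x4 x5; nra.
Qed.

Local Open Scope nat_scope.

(** * Colourings of a cover as sections *)

Lemma adjC (W : finType) (H : sgraph W) u v : adj H u v = adj H v u.
Proof. by rewrite /adj setUC. Qed.

Lemma adj_neq (W : finType) (H : sgraph W) u v : adj H u v -> u != v.
Proof.
by move=> uv; have /forall_inP/(_ _ uv) := edges_card2 H;
  rewrite cards2; case: (u != v).
Qed.

Lemma edges_betweenP (W : finType) (H : sgraph W) (S1 S2 : {set W}) e :
  reflect (exists x y, [/\ x \in S1, y \in S2, adj H x y & e = [set x; y]])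
    (e \in edges_between H S1 S2).
Proof.
rewrite inE; apply: (iffP andP).
  case=> eH /exists_inP[x x1 /exists_inP[y y2 /eqP ee]].
  by exists x, y; split; rewrite // /adj -ee.
case=> x [y [x1 y2 xy ->]]; split=> //; apply/exists_inP; exists x => //.
by apply/exists_inP; exists y.
Qed.

Section Cover.
Variables (V W : finType) (G : sgraph V).
Implicit Types (L : {ffun V -> {set W}}) (H : sgraph W).

Definition cover_sections L H : {set {ffun V -> W}} :=
  [set z : {ffun V -> W} | [forall v, z v \in L v] &
     [forall u, forall v, adj G u v ==> ~~ adj H (z u) (z v)]].

Lemma cover_fiber_exists L H w : is_dp_cover G L H -> exists v, w \in L v.
Proof.
case/and4P=> /andP[/and3P[/eqP/setP/(_ w) cov _ _] _] _ _ _.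
by move: cov; rewrite inE => /bigcupP[_ /imsetP[v _ ->] wv]; exists v.
Qed.

Lemma cover_fiber_inj L H u v w :
  is_dp_cover G L H -> w \in L u -> w \in L v -> u = v.
Proof.
case/and4P=> /andP[/and3P[_ /trivIsetP triv _] card] _ _ _ wu wv.
have L_inj : {in V &, injective L} by apply/imset_injP; rewrite -(eqP card).
apply: L_inj => //; apply/eqP; apply: contraT => uNv.
have := triv _ _ (imset_f L isT) (imset_f L isT) uNv.
by rewrite -setI_eq0 => /eqP/setP/(_ w); rewrite !inE wu wv.
Qed.

(** The lists are cliques, so an independent set meets each of the [#|V|] lists
    at most once; having [#|V|] elements, it meets each exactly once and is the
    image of a section. *)
Lemma num_colorings_le_sections L H : is_dp_cover G L H ->
  num_colorings G H <= #|cover_sections L H|.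
Proof.
move=> cov; have [bl blP] := fin_all_exists (fun w => cover_fiber_exists w cov).
pose im (z : {ffun V -> W}) := z @: V.
apply: leq_trans (leq_imset_card im _).
apply/subset_leq_card/subsetP => S.
rewrite inE => /andP[/forall_inP indS /eqP cardS].
have bl_inj : {in S &, injective bl}.
  move=> w w' wS w'S e; apply/eqP; apply: contraT => ww'.
  have /forall_inP/(_ _ w'S) := indS _ wS.
  case/and4P: cov => _ /forallP/(_ (bl w)) /forall_inP/(_ _ (blP w)).
  by move=> /forall_inP/(_ w'); rewrite {1}e blP ww' => /(_ isT)/= ->.
have blS : bl @: S = [set: V].
  by apply/eqP; rewrite eqEcard subsetT cardsT card_in_imset // cardS leqnn.
have: forall v, exists w, (w \in S) && (bl w == v).
  move=> v; have /imsetP[w wS ->] : v \in bl @: S by rewrite blS inE.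
  by exists w; rewrite wS eqxx.
case/fin_all_exists => z zP.
have zS v : z v \in S by have /andP[] := zP v.
have zL v : bl (z v) = v by have /andP[_ /eqP] := zP v.
apply/imsetP; exists (finfun z).
  rewrite inE; apply/andP; split.
    by apply/forallP => v; rewrite ffunE -{2}(zL v) blP.
  apply/forallP => u; apply/forallP => v; apply/implyP => _; rewrite !ffunE.
  by have /forall_inP := indS _ (zS u); apply.
rewrite /im (eq_imset (g := z)) => [|v]; last by rewrite ffunE.
apply/esym/eqP; rewrite eqEcard (card_imset _ (can_inj zL)) cardS leqnn andbT.
by apply/subsetP => _ /imsetP[v _ ->].
Qed.

(** Edges of a matching have distinct ends in [S1], so [#|S1|] of them saturate
    [S1]; they also have distinct ends in [S2], so partners are distinct. *)
Lemma matching_injection (S1 S2 : {set W}) H :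
  [disjoint S1 & S2] -> trivIset (edges_between H S1 S2) ->
  #|edges_between H S1 S2| = #|S1| ->
  exists s : W -> W, [/\ forall x, x \in S1 -> s x \in S2,
    forall x, x \in S1 -> adj H x (s x) & {in S1 &, injective s}].
Proof.
move=> dis /trivIsetP triv card.
have eb x y : x \in S1 -> y \in S2 -> adj H x y ->
    [set x; y] \in edges_between H S1 S2.
  by move=> x1 y2 xy; apply/edges_betweenP; exists x, y.
have share e e' w :
    e \in edges_between H S1 S2 -> e' \in edges_between H S1 S2 ->
    w \in e -> w \in e' -> e = e'.
  move=> eE e'E we we'; apply/eqP; apply: contraT => /(triv _ _ eE e'E).
  by rewrite -setI_eq0 => /eqP/setP/(_ w); rewrite !inE we we'.
have sep x y : x \in S1 -> y \in S2 -> x != y.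
  by move=> x1 y2; apply: contraTneq y2 => <-; rewrite (disjointFr dis x1).
pose ends := [set x in S1 | [exists y in S2, adj H x y]].
have endsE : ends = S1.
  apply/eqP; rewrite eqEcard; apply/andP; split.
    by apply/subsetP => x; rewrite inE => /andP[].
  (* Edges at a common vertex coincide, so choosing one edge at each vertex of
     S1 that has an edge yields all edges. *)
  rewrite -card; pose pt (x : W) := [set x; odflt x [pick y in S2 | adj H x y]].
  apply: leq_trans (leq_imset_card pt _); apply/subset_leq_card/subsetP => e eE.
  have /edges_betweenP[x [y [x1 y2 xy ee]]] := eE.
  apply/imsetP; exists x.
    by rewrite inE x1; apply/exists_inP; exists y.
  rewrite /pt; case: pickP => [y' /andP[y'2 xy']|/(_ y)]; last by rewrite y2 xy.
  by apply: (share _ _ x) => //; [exact: eb | rewrite ee set21 | rewrite set21].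
have: forall x, exists y, (x \in S1) ==> (y \in S2) && adj H x y.
  move=> x; case: (boolP (x \in S1)) => [|_]; last by exists x.
  by rewrite -{1}endsE inE => /andP[_ /exists_inP[y y2 xy]]; exists y; rewrite y2.
case/fin_all_exists => s sP; exists s.
have s2 x : x \in S1 -> s x \in S2.
  by move=> x1; have := sP x; rewrite x1 => /andP[].
have sa x : x \in S1 -> adj H x (s x).
  by move=> x1; have := sP x; rewrite x1 => /andP[].
split=> // x x' x1 x'1 e.
have ee : [set x; s x] = [set x'; s x'].
  by apply: (share _ _ (s x)); rewrite ?eb ?s2 ?sa // ?set22 // e set22.
have : x \in [set x'; s x'] by rewrite -ee set21.
by rewrite !inE (negbTE (sep x (s x') x1 (s2 _ x'1))) orbF => /eqP.
Qed.

End Cover.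

(** * The canonical cover *)

Lemma graph_of_rel (W : finType) (r : rel W) : symmetric r -> irreflexive r ->
  exists H : sgraph W, forall x y, adj H x y = r x y.
Proof.
move=> r_sym r_irr.
pose E := [set [set p.1; p.2] | p : W * W in [pred p | r p.1 p.2]].
have E2 : [forall e in E, #|e| == 2].
  apply/forall_inP => e /imsetP[[x y]]; rewrite inE /= => rxy ->.
  by rewrite cards2 (_ : x != y) //; apply: contraTneq rxy => ->; rewrite r_irr.
exists (SGraph E2) => x y; apply/imsetP/idP => [[[a b]] /= | rxy];
  last by exists (x, y).
rewrite inE /= => rab e.
have ab : a != b by apply: contraTneq rab => ->; rewrite r_irr.
have /set2P ax : a \in [set x; y] by rewrite e set21.
have /set2P bx : b \in [set x; y] by rewrite e set22.
by case: ax bx ab rab => -> [] -> //; rewrite ?eqxx // r_sym.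
Qed.

Section CanonicalCover.
Variables (V : finType) (G : sgraph V) (k : nat).

Definition proper_colorings : {set {ffun V -> 'I_k}} :=
  [set c : {ffun V -> 'I_k} | [forall u, forall v, adj G u v ==> (c u != c v)]].

(** In the cover that joins equal colours of adjacent vertices, the graph of a
    proper colouring is independent. *)
Lemma proper_colorings_le_dual_DP : 0 < k -> #|proper_colorings| <= dual_DP G k.
Proof.
move=> k_gt0; pose W := (V * 'I_k)%type.
pose r (x y : W) :=
  (x.1 == y.1) && (x.2 != y.2) || adj G x.1 y.1 && (x.2 == y.2).
have r_sym : symmetric r.
  by move=> x y; rewrite /r (adjC _ x.1) (eq_sym x.1) (eq_sym x.2).
have adj_irr u : adj G u u = false by apply/negP => /adj_neq; rewrite eqxx.
have r_irr : irreflexive r by move=> x; rewrite /r adj_irr !eqxx.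
have [H adjH] := graph_of_rel r_sym r_irr.
pose L := [ffun v => [set x : W | x.1 == v]].
have inL v x : (x \in L v) = (x.1 == v) by rewrite ffunE inE.
have L_inj : injective L.
  move=> u v Luv; have := inL v (u, Ordinal k_gt0).
  by rewrite -Luv inL eqxx => /esym/eqP.
have betw u v : adj G u v ->
    edges_between H (L u) (L v) = [set [set (u, i); (v, i)] | i : 'I_k].
  move=> uv; apply/setP => e; apply/edges_betweenP/imsetP.
    case=> -[a i] [[b j]] []; rewrite !inL /= => /eqP-> /eqP->.
    by rewrite adjH /r /= (negbTE (adj_neq uv)) => /andP[_ /eqP->] ->; exists j.
  case=> i _ ->; exists (u, i), (v, i); split; rewrite ?inL //.
  by rewrite adjH /r /= uv eqxx orbT.
have cov : is_full_fold_cover G k L H.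
  apply/and3P; split; first (apply/and4P; split).
  - rewrite card_imset // eqxx andbT; apply/and3P; split.
    + apply/eqP/setP => x; rewrite inE; apply/bigcupP.
      by exists (L x.1); rewrite ?imset_f // inL.
    + apply/trivIsetP => _ _ /imsetP[u _ ->] /imsetP[v _ ->].
      rewrite (inj_eq L_inj) => uNv; rewrite -setI_eq0; apply/eqP/setP => x.
      rewrite inE !inL [RHS]inE; apply/negP => /andP[/eqP xu /eqP xv].
      by rewrite -xu -xv eqxx in uNv.
    + apply/imsetP => -[v _] /setP/(_ (v, Ordinal k_gt0)).
      by rewrite inL inE eqxx.
  - apply/forallP => v; apply/forall_inP => x; rewrite inL => /eqP xv.
    apply/forall_inP => y; rewrite inL => /eqP yv; rewrite adjH /r xv yv eqxx.
    apply/implyP; apply: contraR; rewrite negb_or negbK => /andP[/eqP e _].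
    by rewrite (surjective_pairing x) (surjective_pairing y) xv yv e.
  - apply/forallP => u; apply/forallP => v; apply/implyP => /set0Pn[e].
    case/edges_betweenP=> x [y []]; rewrite !inL => /eqP<- /eqP<-; rewrite adjH.
    by case/orP=> /andP[-> _]; rewrite ?orbT.
  - apply/forallP => u; apply/forallP => v; apply/implyP => uv; rewrite betw //.
    apply/trivIsetP => _ _ /imsetP[i _ ->] /imsetP[j _ ->]; apply: contraR.
    rewrite -setI_eq0 => /set0Pn[[a l]]; rewrite !inE !xpair_eqE.
    by case/andP=> /orP[]/andP[_ /eqP<-] /orP[]/andP[_ /eqP<-].
  - apply/forallP => v; rewrite (_ : L v = setX [set v] setT).
      by rewrite cardsX cards1 cardsT card_ord mul1n.
    by apply/setP => x; rewrite inL !inE andbT.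
  apply/forallP => u; apply/forallP => v; apply/implyP => uv; rewrite betw //.
  rewrite card_imset ?card_ord // => i j eij.
  have : (u, i) \in [set (u, j); (v, j)] by rewrite -eij set21.
  by rewrite !inE !xpair_eqE => /orP[]/andP[_ /eqP].
apply: leq_trans (dual_DP_ge cov).
pose F (c : {ffun V -> 'I_k}) := [set (v, c v) | v : V].
have inF c v i : ((v, i) \in F c) = (i == c v).
  by apply/imsetP/eqP => [[u _ [-> ->]]//|->]; exists v.
rewrite -(card_imset (f := F)) => [|c d /setP cd]; last first.
  by apply/ffunP => v; apply/eqP; rewrite -inF -cd inF.
apply/subset_leq_card/subsetP => _ /imsetP[c c_prop ->]; move: c_prop.
rewrite !inE => /forallP c_prop; rewrite card_imset ?eqxx ?andbT => [|u v []//].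
apply/forall_inP => _ /imsetP[u _ ->]; apply/forall_inP => _ /imsetP[v _ ->].
rewrite adjH /r /=; apply/norP; split.
  by rewrite negb_and negbK; case: eqVneq => //= ->; rewrite eqxx.
by rewrite negb_and -implybE; have /forallP := c_prop u; apply.
Qed.

End CanonicalCover.

(** * The dual DP colour function of a complete bipartite graph *)

(** The arithmetic-geometric mean inequality for the numbers f b ^ #|B|. *)
Lemma nat_AGM (B : finType) (f : B -> nat) :
  #|B| * \prod_b f b <= \sum_b f b ^ #|B|.
Proof.
have [->//|n_gt0] := posnP #|B|.
rewrite -(leq_exp2r _ _ n_gt0) -(ler_nat rat) expnMn natrM.
have [] := leif_AGM (A := B) (E := fun b => (f b ^ #|B|)%:R : rat).
  by move=> b _; exact: ler0n.
rewrite -natr_prod -natr_sum expr_div_n -!natrX.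
rewrite ler_pdivlMr ?ltr0n ?expn_gt0 ?n_gt0 //.
rewrite (big_morph (expn^~ #|B|) (fun u v => expnMn u v _) (exp1n _)) mulrC.
by move=> le _.
Qed.

Lemma adj_Kmn m n i j : adj (Kmn m n) (inl i) (inr j).
Proof. by apply/imset2P; exists i j. Qed.

Lemma disjoint_pairs_le_dual_DP m n k : 0 < k ->
  #|disjoint_pairs 'I_m 'I_n [set: 'I_k] [set: 'I_k]| <= dual_DP (Kmn m n) k.
Proof.
move=> k_gt0; apply: leq_trans (proper_colorings_le_dual_DP _ k_gt0).
pose F (p : {ffun 'I_m -> 'I_k} * {ffun 'I_n -> 'I_k}) :
    {ffun 'I_m + 'I_n -> 'I_k} :=
  [ffun v => match v with inl i => p.1 i | inr j => p.2 j end].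
rewrite -(card_imset (f := F)) => [|[x y] [x' y'] /ffunP e]; last first.
  by congr pair; apply/ffunP => i; [have := e (inl i) | have := e (inr i)];
    rewrite !ffunE.
apply/subset_leq_card/subsetP => _ /imsetP[[x y] + ->].
rewrite inE => /and3P[_ _ /forallP d]; rewrite inE.
have dF i j : F (x, y) (inl i) != F (x, y) (inr j).
  by rewrite !ffunE; have /forallP := d i; apply.
apply/forallP => u; apply/forallP => v; apply/implyP => uv.
have /imset2P[i j _ _ e] := uv.
have /set2P ue : u \in [set inl i; inr j] by rewrite -e set21.
have /set2P ve : v \in [set inl i; inr j] by rewrite -e set22.
case: ue ve (adj_neq uv) => -> [] -> //; rewrite ?eqxx // => _.
by rewrite eq_sym dF.
Qed.

Section UpperBound.
Variables (m n k : nat) (W : finType).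
Variables (L : {ffun 'I_m + 'I_n -> {set W}}) (H : sgraph W).
Hypotheses (n_gt0 : 0 < n) (k_gt0 : 0 < k).
Hypothesis cov : is_full_fold_cover (Kmn m n) k L H.

Lemma matching_injections : exists s : 'I_m * 'I_n -> W -> W, forall i j,
  [/\ forall x, x \in L (inl i) -> s (i, j) x \in L (inr j),
      forall x, x \in L (inl i) -> adj H x (s (i, j) x)
    & {in L (inl i) &, injective (s (i, j))}].
Proof.
case/and3P: cov => dp /forallP fold /forallP full.
have: forall p : 'I_m * 'I_n, exists s : W -> W,
  [/\ forall x, x \in L (inl p.1) -> s x \in L (inr p.2),
      forall x, x \in L (inl p.1) -> adj H x (s x)
    & {in L (inl p.1) &, injective s}].
  case=> i j; apply: matching_injection.
  - rewrite -setI_eq0; apply/eqP/setP => w; rewrite !inE; apply/andP => -[wi wj].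
    by have := cover_fiber_inj dp wi wj.
  - case/and4P: dp => _ _ _ /forallP/(_ (inl i))/forallP/(_ (inr j)).
    by rewrite adj_Kmn.
  - rewrite (eqP (fold _)); have /forallP/(_ (inr j)) := full (inl i).
    by rewrite adj_Kmn => /eqP.
case/fin_all_exists=> s sP; exists s => i j; exact: (sP (i, j)).
Qed.

(** Fixing the colours on the left, the right vertices are independent of each
    other; [nat_AGM] then separates them, and for one right vertex j the
    matchings only relabel the left colours by colours of the list of j. *)
Lemma num_colorings_Kmn_le :
  num_colorings (Kmn m n) H <=
  #|disjoint_pairs 'I_m 'I_n [set: 'I_k] [set: 'I_k]|.
Proof.
case/and3P: (cov) => dp /forallP fold _; have [s sP] := matching_injections.
set N := #|disjoint_pairs _ _ _ _|.
pose X := [set x : {ffun 'I_m -> W} | x \in family (fun i => mem (L (inl i)))].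
pose phi j (x : {ffun 'I_m -> W}) := [ffun i => s (i, j) (x i)].
pose free j (z : {ffun 'I_m -> W}) := L (inr j) :\: z @: 'I_m.
have step1 : num_colorings (Kmn m n) H <=
    \sum_(x in X) \prod_j #|free j (phi j x)|.
  apply: leq_trans (num_colorings_le_sections dp) _.
  have -> : \sum_(x in X) \prod_j #|free j (phi j x)| =
      \sum_(x in X) #|[pred y : {ffun 'I_n -> W} |
        y \in family (fun j => mem (free j (phi j x)))]|.
    by apply: eq_bigr => x _; rewrite card_family foldrE big_image.
  under eq_bigr => x _ do rewrite -sum1_card.
  rewrite pair_big_dep sum1dep_card.
  pose F (z : {ffun 'I_m + 'I_n -> W}) :=
    ([ffun i => z (inl i)], [ffun j => z (inr j)]).
  rewrite -(card_imset (f := F)) => [|z z' [/ffunP e1 /ffunP e2]]; last first.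
    by apply/ffunP => -[i|j]; [have := e1 i | have := e2 j]; rewrite !ffunE.
  apply/subset_leq_card/subsetP => _ /imsetP[z zP ->].
  rewrite inE in zP; case/andP: zP => /forallP zL /forallP zI.
  rewrite !inE /=; apply/andP; split.
    by apply/forallP => i; rewrite ffunE; exact: zL.
  apply/forallP => j; rewrite !inE ffunE zL andbT; apply/imsetP => -[i _].
  rewrite !ffunE => e; have /forallP/(_ (inr j)) := zI (inl i).
  rewrite adj_Kmn e; have [_ -> //] := sP i j; exact: zL.
have step2 j : \sum_(x in X) #|free j (phi j x)| ^ n <= N.
  apply: leq_trans (_ : #|disjoint_pairs 'I_m 'I_n (L (inr j)) (L (inr j))| <= _);
    last first.
    apply: (leq_disjoint_pairs _ _ (Ordinal k_gt0)).
    by rewrite cardsT card_ord (eqP (fold _)).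
  rewrite card_disjoint_pairs card_ord.
  rewrite -(big_imset (h := phi j) (fun z => #|free j z| ^ n)) /= => [|x x'];
    last first.
    rewrite !inE => /forallP xL /forallP x'L /ffunP e; apply/ffunP => i.
    by have := e i; rewrite !ffunE; have [_ _] := sP i j; apply.
  apply: (@sub_le_big _ _ leq leqnn (fun a b => leq_addr b a)) => z.
  case/imsetP=> x; rewrite inE => /forallP xL ->.
  by apply/ffun_onP => i; rewrite ffunE; have [sL _ _] := sP i j; exact: sL.
rewrite -(leq_pmul2l n_gt0) (leq_trans (leq_mul (leqnn n) step1)) //.
rewrite big_distrr.
apply: leq_trans (_ : \sum_(x in X) \sum_j #|free j (phi j x)| ^ n <= _).
  apply: leq_sum => x _.
  by have := nat_AGM (fun j => #|free j (phi j x)|); rewrite card_ord.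
rewrite exchange_big /=; apply: (@leq_trans (\sum_(j < n) N)).
  by apply: leq_sum => j _; exact: step2.
by rewrite sum_nat_const card_ord.
Qed.
End UpperBound.

Lemma dual_DP_Kmn m n k : 0 < n -> 0 < k ->
  dual_DP (Kmn m n) k = #|disjoint_pairs 'I_m 'I_n [set: 'I_k] [set: 'I_k]|.
Proof.
move=> n_gt0 k_gt0; apply/eqP; rewrite eqn_leq disjoint_pairs_le_dual_DP // andbT.
by apply/bigmax_leqP => -[L H] /= cov; exact: num_colorings_Kmn_le cov.
Qed.

Local Open Scope ring_scope.

Theorem corollary11 (m n k : nat) (m_gt0 : (0 < m)%N) (n_gt0 : (0 < n)%N)
    (k_gt0 : (0 < k)%N) (k_ge : (m + n - 1 <= k)%N) :
  (dual_DP (Kmn m n) k.+1)%:R / (k.+1)%:R ^+ (m + n)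
    >= (dual_DP (Kmn m n) k)%:R / k%:R ^+ (m + n) :> rat.
Proof.
rewrite !dual_DP_Kmn //.
have := @disjoint_pairs_growth 'I_m 'I_n k k_gt0; rewrite !card_ord.
have le : (m + n <= k.+1)%N by lia.
move=> /(_ le); have k0 : 0 < k%:R :> rat by rewrite ltr0n.
have -> : 1 + k%:R^-1 = k.+1%:R / k%:R :> rat by rewrite -natr1; field; lra.
rewrite ler_pdivlMr ?exprn_gt0 ?ltr0n // expr_div_n.
by move=> h; rewrite [leLHS]mulrC [X in _ * X <= _]mulrC mulrA.
Qed.
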